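(* Let $y_0>0$ and, for real $\varepsilon$, let $y(\tau)=y(\tau;\varepsilon)>0$ be the solution of $$y'''+4y'=\varepsilon\cos(\tau)\,y^{-5/2},\qquad y(0)=y_0,\quad y'(0)=0,\quad y''(0)=0 .$$ Then, for each fixed $\tau$, as $\varepsilon\to0$, $$y(\tau)=y_0\exp\!\big(\varepsilon\rho_1(\tau)+\varepsilon^2\rho_2(\tau)+\varepsilon^3\rho_3(\tau)+O(\varepsilon^4)\big),$$ where $$\rho_1(\tau)=y_0^{-7/2}\Big(\tfrac13\sin\tau-\tfrac16\sin2\tau\Big),$$ $$\rho_2(\tau)=y_0^{-7}\Big[-\tfrac{5}{288}-\tfrac1{24}\cos\tau+\tfrac{19}{288}\cos2\tau-\tfrac1{72}\cos3\tau+\tfrac1{144}\cos4\tau+\tfrac5{96}\,\tau\sin2\tau\Big],$$ $$\begin{aligned}\rho_3(\tau)=\frac{1}{2592\,y_0^{21/2}}\Big[&-\tfrac{45}{4}\tau+\tfrac{135}{4}\tau\cos\tau-\tfrac{45}{2}\tau\cos2\tau+\tfrac{45}{4}\tau\cos3\tau-\tfrac{45}{4}\tau\cos4\tau\\&+\tfrac{159}{2}\sin\tau-\tfrac{327}{4}\sin2\tau+\tfrac{73}{4}\sin3\tau+\tfrac{69}{8}\sin4\tau-\tfrac94\sin5\tau+\sin6\tau\Big].\end{aligned}$$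
   Context: Primes denote derivatives with respect to $\tau$; all quantities are real. *)

(* Defs.v *)
From Stdlib Require Import Reals.
From Coquelicot Require Import Coquelicot.
Open Scope R_scope.

Definition in_interval (a b : Rbar) (t : R) : Prop :=
  Rbar_lt a t /\ Rbar_lt t b.

(* Since [Derive_n] is total, [ex_derive_n y 3 t] alone does not imply that the
   lower-order derivatives exist at [t]; they are all required. *)
Definition is_solution (y0 eps : R) (a b : Rbar) (y : R -> R) : Prop :=
  in_interval a b 0 /\
  (forall t : R, in_interval a b t ->
     0 < y t /\
     (forall n : nat, (n <= 3)%nat -> ex_derive_n y n t) /\
     Derive_n y 3 t + 4 * Derive y t = eps * cos t * Rpower (y t) (- (5 / 2))) /\
  y 0 = y0 /\ Derive y 0 = 0 /\ Derive_n y 2 0 = 0.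

(* A positive solution may cease to exist in finite time, so the solution of the
   initial value problem is the one that has no proper extension. *)
Definition is_maximal_solution (y0 eps : R) (a b : Rbar) (y : R -> R) : Prop :=
  is_solution y0 eps a b y /\
  forall (a' b' : Rbar) (z : R -> R),
    is_solution y0 eps a' b' z ->
    Rbar_le a' a -> Rbar_le b b' ->
    (forall t : R, in_interval a b t -> z t = y t) ->
    a' = a /\ b' = b.

Definition rho1 (y0 tau : R) : R :=
  Rpower y0 (- (7 / 2)) * (1 / 3 * sin tau - 1 / 6 * sin (2 * tau)).

Definition rho2 (y0 tau : R) : R :=
  / y0 ^ 7 *
  (- (5 / 288) - 1 / 24 * cos tau + 19 / 288 * cos (2 * tau)
   - 1 / 72 * cos (3 * tau) + 1 / 144 * cos (4 * tau)
   + 5 / 96 * tau * sin (2 * tau)).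

Definition rho3 (y0 tau : R) : R :=
  1 / (2592 * Rpower y0 (21 / 2)) *
  (- (45 / 4) * tau + 135 / 4 * tau * cos tau - 45 / 2 * tau * cos (2 * tau)
   + 45 / 4 * tau * cos (3 * tau) - 45 / 4 * tau * cos (4 * tau)
   + 159 / 2 * sin tau - 327 / 4 * sin (2 * tau) + 73 / 4 * sin (3 * tau)
   + 69 / 8 * sin (4 * tau) - 9 / 4 * sin (5 * tau) + sin (6 * tau)).

(* Main.v *)
Require Import Defs.
From Stdlib Require Import Reals Lra Lia Psatz List.
From Coquelicot Require Import Coquelicot.
Open Scope R_scope.

(** Write [y = y0 * exp P] and [e = eps * y0 ^ (- 7/2)]. The equation becomes
    [P''' + 4 P' + 3 P' P'' + P' ^ 3 = e cos t exp (- 7/2 P)], and the [rho_k]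
    are, up to scaling, the solutions of its first three orders in [e]. Hence
    [Y = y0 * exp (e p1 + e ^ 2 p2 + e ^ 3 p3)] solves the equation for [y] up to
    a residual [O (e ^ 4)], uniformly on compact intervals, and Gronwall's lemma
    for the energy [w ^ 2 + w' ^ 2 + w'' ^ 2] of [w = y - Y] gives
    [y - Y = O (eps ^ 4)]. That the maximal solution reaches [tau] and stays above
    [y0 / 2] for small [eps] comes from a solution on [(- T, T)] obtained by
    Picard iteration: it agrees with the maximal solution on the common interval,
    so gluing the two would otherwise produce a proper extension. *)

(** * Gronwall estimates *)

(* [auto_derive] leaves eta-expanded [Derive (fun x => f x)], which a plain
   [rewrite is_derive_unique] does not match. *)
Ltac rw_derive H :=
  let E := fresh in
  match type of H with
  | is_derive ?f ?s ?l =>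
      assert (E : Derive (fun x : R => f x) s = l)
        by (apply is_derive_unique; exact H);
      rewrite E; clear E
  end.

Lemma exp_monotone (x y : R) : x <= y -> exp x <= exp y.
Proof.
  intros [H | ->]; [left; now apply exp_increasing | apply Rle_refl].
Qed.

(** With [sg] the sign of [t], the function [f s * exp (- k * sg * s)] does not increase on the way
    from 0 to [t]. The two-sided bound on [f'] lets one argument serve both directions of time. *)
Lemma gronwall (f f' : R -> R) (k t : R) :
  (forall s, Rmin 0 t <= s <= Rmax 0 t ->
     is_derive f s (f' s) /\ Rabs (f' s) <= k * f s) ->
  f t <= f 0 * exp (k * Rabs t).
Proof.
  intros H.
  assert (Hs : exists sg, sg * sg = 1 /\ t = sg * Rabs t).
  { destruct (Rle_dec 0 t).
    - exists 1. rewrite Rabs_pos_eq by assumption. lra.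
    - exists (-1). rewrite Rabs_left by lra. lra. }
  destruct Hs as [sg [Hsg Ht]].
  assert (Hd : forall s, Rmin 0 t <= s <= Rmax 0 t ->
    is_derive (fun s => f s * exp (- k * sg * s)) s
      ((f' s - k * sg * f s) * exp (- k * sg * s))).
  { intros s Hs. destruct (H s Hs) as [Hf _].
    auto_derive.
    - now exists (f' s).
    - rw_derive Hf. ring. }
  destruct (MVT_gen (fun s => f s * exp (- k * sg * s)) 0 t
    (fun s => (f' s - k * sg * f s) * exp (- k * sg * s))) as [c [Hc E]].
  - intros s Hs. apply Hd. lra.
  - intros s Hs. apply derivable_continuous_pt.
    eexists. apply is_derive_Reals, Hd, Hs.
  - destruct (H c Hc) as [_ Hb].
    assert (Hle : f t * exp (- k * sg * t) <= f 0).
    { rewrite Rmult_0_r, exp_0, Rmult_1_r, Rminus_0_r in E.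
      assert (Hp := exp_pos (- k * sg * c)).
      assert (Hn : (f' c - k * sg * f c) * t <= 0).
      { replace ((f' c - k * sg * f c) * t)
          with ((sg * f' c - k * f c * (sg * sg)) * Rabs t)
          by (rewrite Ht at 2; ring).
        rewrite Hsg.
        assert (Hq := Rabs_pos t).
        assert (sg * f' c <= k * f c).
        { apply Rle_trans with (2 := Hb).
          apply Rle_trans with (1 := Rle_abs _).
          rewrite Rabs_mult.
          assert (Rabs sg * Rabs sg = 1)
            by (rewrite <- Rabs_mult, Hsg; apply Rabs_R1).
          assert (Rabs sg = 1) by (assert (Hr := Rabs_pos sg); nra).
          rewrite H1. lra. }
        nra. }
      nra. }
    assert (Hk : - k * sg * t = - (k * Rabs t))
      by (rewrite Ht at 1; replace (- k * sg * (sg * Rabs t))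
            with (- k * (sg * sg) * Rabs t) by ring; rewrite Hsg; ring).
    rewrite Hk, exp_Ropp in Hle.
    assert (Hp := exp_pos (k * Rabs t)).
    apply Rmult_le_reg_r with (/ exp (k * Rabs t)).
    + now apply Rinv_0_lt_compat.
    + replace (f 0 * exp (k * Rabs t) * / exp (k * Rabs t)) with (f 0)
        by (field; lra). exact Hle.
Qed.

(** Adding the constant [d * d] to the energy absorbs the inhomogeneous term, so that [gronwall]
    applies with initial value [d * d]. Young's inequality bounds the cross terms; the rate [7 + L]
    is not sharp. The case [d = 0] yields uniqueness, and [d] of order [eps ^ 4] the error of the
    expansion. *)
Lemma stability (w w1 w2 w3 : R -> R) (L d t : R) :
  0 <= L -> 0 <= d -> w 0 = 0 -> w1 0 = 0 -> w2 0 = 0 ->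
  (forall s, Rmin 0 t <= s <= Rmax 0 t ->
     is_derive w s (w1 s) /\ is_derive w1 s (w2 s) /\ is_derive w2 s (w3 s) /\
     Rabs (w3 s + 4 * w1 s) <= L * Rabs (w s) + d) ->
  Rabs (w t) <= d * exp ((7 + L) * Rabs t).
Proof.
  intros HL Hd Z Z1 Z2 H.
  assert (G := gronwall (fun s => w s * w s + w1 s * w1 s + w2 s * w2 s + d * d)
    (fun s => 2 * (w s * w1 s + w1 s * w2 s + w2 s * w3 s)) (7 + L) t).
  cbv beta in G. rewrite Z, Z1, Z2 in G.
  assert (G' : w t * w t + w1 t * w1 t + w2 t * w2 t + d * d
     <= d * d * exp ((7 + L) * Rabs t)).
  { replace (d * d) with (0 * 0 + 0 * 0 + 0 * 0 + d * d) at 2 by ring.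
    apply G. intros s Hs. destruct (H s Hs) as (D0 & D1 & D2 & B). split.
    - auto_derive.
      + repeat split; eexists; eassumption.
      + rw_derive D0. rw_derive D1. rw_derive D2. ring.
    - set (h := w3 s + 4 * w1 s) in *.
      replace (w3 s) with (h - 4 * w1 s) by (unfold h; ring).
      assert (Hh : Rabs (w2 s * h) <=
        Rabs (w2 s) * (L * Rabs (w s) + d)).
      { rewrite Rabs_mult. apply Rmult_le_compat_l; [apply Rabs_pos | exact B]. }
      assert (S0 : Rabs (w s) * Rabs (w s) = w s * w s)
        by (symmetry; apply Rsqr_abs).
      assert (S2 : Rabs (w2 s) * Rabs (w2 s) = w2 s * w2 s)
        by (symmetry; apply Rsqr_abs).
      generalize dependent (Rabs (w s)). generalize dependent (Rabs (w2 s)).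
      intros A S2 B0 B1 Hh S0.
      assert (Hh' : 2 * Rabs (w2 s * h)
         <= L * (w s * w s + w2 s * w2 s) + (w2 s * w2 s + d * d)).
      { assert (0 <= (A - B0) * (A - B0)) by apply Rle_0_sqr.
        assert (0 <= (A - d) * (A - d)) by apply Rle_0_sqr.
        assert (0 <= L * ((A - B0) * (A - B0))) by (apply Rmult_le_pos; assumption).
        nra. }
      assert (Hab := Rle_abs (w2 s * h)).
      assert (Hab' := Rle_abs (- (w2 s * h))). rewrite Rabs_Ropp in Hab'.
      assert (0 <= L * (w1 s * w1 s + d * d))
        by (apply Rmult_le_pos; [assumption | nra]).
      assert (Q0 := Rle_0_sqr (w s)). assert (Q1 := Rle_0_sqr (w1 s)).
      assert (Q2 := Rle_0_sqr (w2 s)). assert (Q3 := Rle_0_sqr d).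
      assert (P0 := Rle_0_sqr (w s + w1 s)).
      assert (P1 := Rle_0_sqr (w s - w1 s)).
      assert (P2 := Rle_0_sqr (w1 s + w2 s)).
      assert (P3 := Rle_0_sqr (w1 s - w2 s)).
      unfold Rsqr in *. apply Rabs_le. split; lra. }
  (* The energy bounds the square of [w t]. As the exponential is at least 1, it may be replaced by
     its own square before taking roots. *)
  assert (He : 1 <= exp ((7 + L) * Rabs t)).
  { rewrite <- exp_0. apply exp_monotone.
    apply Rmult_le_pos; [lra | apply Rabs_pos]. }
  apply Rsqr_incr_0_var; [|apply Rmult_le_pos; lra].
  rewrite <- Rsqr_abs. unfold Rsqr.
  set (e := exp ((7 + L) * Rabs t)) in *.
  assert (0 <= d * d * e * (e - 1)).
  { apply Rmult_le_pos; [|lra]. apply Rmult_le_pos; [nra | lra]. }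
  nra.
Qed.

Lemma Rpower_decr (c z p : R) : 0 < c <= z -> p <= 0 -> Rpower z p <= Rpower c p.
Proof.
  intros Hc Hp. unfold Rpower. apply exp_monotone.
  assert (ln c <= ln z) by (apply ln_le; lra).
  nra.
Qed.

Lemma is_derive_Rpower (x p : R) :
  0 < x -> is_derive (fun z => Rpower z p) x (p * Rpower x (p - 1)).
Proof. intros Hx. now apply is_derive_Reals, derivable_pt_lim_power. Qed.

(** For [p <= 1] the power [p - 1] is nonincreasing in the base, so on [[c, oo)] the derivative is
    largest in absolute value at [c]. *)
Lemma Rpower_lipschitz (c p : R) :
  0 < c -> p <= 1 -> forall x y, c <= x -> c <= y ->
  Rabs (Rpower x p - Rpower y p) <= Rabs p * Rpower c (p - 1) * Rabs (x - y).
Proof.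
  intros Hc Hp x y Hx Hy.
  assert (Hm : c <= Rmin y x) by now apply Rmin_glb.
  destruct (MVT_gen (fun z => Rpower z p) y x (fun z => p * Rpower z (p - 1)))
    as [z [Hz E]].
  - intros z Hz. apply is_derive_Rpower. lra.
  - intros z Hz. apply derivable_continuous_pt. eexists.
    apply is_derive_Reals, is_derive_Rpower. lra.
  - rewrite E, 2!Rabs_mult. apply Rmult_le_compat_r; [apply Rabs_pos|].
    apply Rmult_le_compat_l; [apply Rabs_pos|].
    rewrite Rabs_pos_eq by (left; apply exp_pos).
    apply Rpower_decr; lra.
Qed.

(** * Fixed points and the linear equation *)

(** The contraction principle for the sup distance on continuous functions on the line. This
    distance can be infinite; [D] makes the first step finite, and the geometric series then bounds
    all distances between iterates. The limit is uniform, hence continuous. *)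
Lemma banach_fixed_point (A : (R -> R) -> R -> R) (q D : R) (u0 : R -> R) :
  0 <= q < 1 -> continuity u0 ->
  (forall u, continuity u -> continuity (A u)) ->
  (forall u v M, continuity u -> continuity v ->
     (forall s, Rabs (u s - v s) <= M) ->
     forall t, Rabs (A u t - A v t) <= q * M) ->
  (forall t, Rabs (A u0 t - u0 t) <= D) ->
  exists u, continuity u /\ forall t, A u t = u t.
Proof.
  intros Hq Hu0 HA Hlip HD.
  set (U n := Nat.iter n A u0).
  assert (HU : forall n, continuity (U n)).
  { induction n as [|n IH]; [exact Hu0 | exact (HA _ IH)]. }
  assert (Hstep : forall n t, Rabs (U (S n) t - U n t) <= q ^ n * D).
  { induction n as [|n IH]; intros t.
    - rewrite pow_O, Rmult_1_l. apply HD.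
    - simpl pow. rewrite Rmult_assoc.
      exact (Hlip _ _ _ (HU (S n)) (HU n) IH t). }
  set (E := D / (1 - q)).
  assert (HE : 0 <= E).
  { assert (0 <= D) by (apply Rle_trans with (2 := HD 0); apply Rabs_pos).
    apply Rmult_le_pos; [assumption|]. left. apply Rinv_0_lt_compat. lra. }
  assert (Hpow : forall n, 0 <= q ^ n) by (intros n; apply pow_le; lra).
  assert (Hdist : forall n m t, Rabs (U (n + m)%nat t - U n t) <= E * q ^ n).
  { intros n m t.
    (* This is the exact partial sum of the geometric series of steps, which makes the induction on
       [m] close. *)
    apply Rle_trans with (E * (q ^ n - q ^ (n + m))).
    - induction m as [|m IH].
      + rewrite Nat.add_0_r, !Rminus_diag, Rabs_R0. lra.
      + rewrite Nat.add_succ_r.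
        replace (U (S (n + m)) t - U n t) with
          ((U (S (n + m)) t - U (n + m)%nat t) + (U (n + m)%nat t - U n t))
          by ring.
        apply Rle_trans with (1 := Rabs_triang _ _).
        assert (Hs := Hstep (n + m)%nat t).
        replace (E * (q ^ n - q ^ S (n + m))) with
          (q ^ (n + m) * D + E * (q ^ n - q ^ (n + m)))
          by (unfold E; simpl; field; lra).
        lra.
    - apply Rmult_le_compat_l; [exact HE|]. assert (Hp := Hpow (n + m)%nat). lra. }
  assert (Hsmall : forall e, 0 < e ->
    exists N, forall n, (N <= n)%nat -> E * q ^ n < e).
  { intros e He.
    (* [E] may be zero, hence the division by [E + 1]. *)
    destruct (pow_lt_1_zero q) with (y := e / (E + 1)) as [N HN].
    - rewrite Rabs_pos_eq; lra.
    - apply Rdiv_lt_0_compat; lra.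
    - exists N. intros n Hn. specialize (HN n Hn).
      rewrite Rabs_pos_eq in HN by apply Hpow.
      apply Rle_lt_trans with ((E + 1) * q ^ n).
      + assert (Hp := Hpow n). lra.
      + apply Rmult_lt_compat_l with (r := E + 1) in HN; [|lra].
        replace ((E + 1) * (e / (E + 1))) with e in HN by (field; lra).
        exact HN. }
  set (u t := real (Lim_seq (fun n => U n t))).
  assert (Hlim : forall t, is_lim_seq (fun n => U n t) (u t)).
  { intros t. apply Lim_seq_correct', ex_lim_seq_cauchy_corr.
    intros e. destruct (Hsmall (e / 2)) as [N HN].
    { assert (He := cond_pos e). lra. }
    exists N. intros n m Hn Hm.
    assert (H1 := Hdist N (n - N)%nat t). assert (H2 := Hdist N (m - N)%nat t).
    rewrite Nat.add_comm, Nat.sub_add in H1, H2 by assumption.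
    specialize (HN N (Nat.le_refl N)).
    apply Rabs_lt_between. apply Rabs_le_between in H1, H2. lra. }
  assert (Hu : forall n t, Rabs (u t - U n t) <= E * q ^ n).
  { intros n t.
    assert (Hl : is_lim_seq (fun m => U (m + n)%nat t) (u t))
      by (apply -> (is_lim_seq_incr_n (fun k => U k t) n (u t)); apply Hlim).
    assert (Hb : forall m, U n t - E * q ^ n <= U (m + n)%nat t
                           <= U n t + E * q ^ n).
    { intros m. assert (H := Hdist n m t). rewrite Nat.add_comm in H.
      apply Rabs_le_between in H. lra. }
    assert (H1 := is_lim_seq_le _ _ _ _ (fun m => proj1 (Hb m))
      (is_lim_seq_const _) Hl).
    assert (H2 := is_lim_seq_le _ _ _ _ (fun m => proj2 (Hb m))
      Hl (is_lim_seq_const _)).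
    simpl in H1, H2. apply Rabs_le. lra. }
  assert (Hc : continuity u).
  { intros t. apply CVU_continuity with (fn := U) (x := t) (r := mkposreal 1 Rlt_0_1).
    - intros e He. destruct (Hsmall e He) as [N HN].
      exists N. intros n s Hn _.
      apply Rle_lt_trans with (1 := Hu n s). now apply HN.
    - intros n s _. apply HU.
    - unfold Boule. simpl. rewrite Rminus_diag, Rabs_R0. lra. }
  exists u. split; [exact Hc|].
  (* Both [A u t] and [u t] are within [e / 2] of [U (S N) t]: the first by contraction applied to
     [u] and [U N], the second by convergence. *)
  intros t. apply cond_eq. intros e He.
  destruct (Hsmall (e / 2)) as [N HN]; [lra|].
  assert (H1 := Hlip u (U N) _ Hc (HU N) (Hu N) t).
  assert (H2 := Hu (S N) t). change (A (U N) t) with (U (S N) t) in H1.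
  assert (H3 := HN N (Nat.le_refl N)).
  assert (H4 := HN (S N) (Nat.le_succ_diag_r N)).
  assert (q * (E * q ^ N) <= E * q ^ N).
  { assert (0 <= E * q ^ N) by (apply Rmult_le_pos; auto). nra. }
  apply Rabs_def1; apply Rabs_le_between in H1, H2; lra.
Qed.

Lemma lipschitz_continuity (f : R -> R) (L : R) :
  (forall x y, Rabs (f x - f y) <= L * Rabs (x - y)) -> continuity f.
Proof.
  intros H x e He. exists (e / (Rabs L + 1)).
  assert (HL := Rabs_pos L). assert (HL' := Rle_abs L).
  split; [apply Rdiv_lt_0_compat; lra|].
  intros y [_ Hy]. unfold dist in *; simpl in *; unfold Rdist in *.
  apply Rle_lt_trans with (1 := H y x).
  apply Rle_lt_trans with ((Rabs L + 1) * Rabs (y - x)).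
  - apply Rmult_le_compat_r; [apply Rabs_pos | lra].
  - apply Rmult_lt_compat_l with (r := Rabs L + 1) in Hy; [|lra].
    replace ((Rabs L + 1) * (e / (Rabs L + 1))) with e in Hy by (field; lra).
    exact Hy.
Qed.

Lemma is_derive_primitive (f : R -> R) (t : R) :
  continuity f -> is_derive (fun t => RInt f 0 t) t (f t).
Proof.
  intros Hf. apply is_derive_RInt with (a := 0).
  - apply filter_forall. intros x. apply @RInt_correct, ex_RInt_continuous.
    intros z _. apply continuity_pt_filterlim, Hf.
  - apply continuity_pt_filterlim, Hf.
Qed.

Lemma primitive_dist (f g : R -> R) (M t : R) :
  continuity f -> continuity g -> (forall s, Rabs (f s - g s) <= M) ->
  Rabs (RInt f 0 t - RInt g 0 t) <= M * Rabs t.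
Proof.
  intros Hf Hg H.
  assert (Hd : forall s, is_derive (fun t => RInt f 0 t - RInt g 0 t) s (f s - g s)).
  { intros s. apply @is_derive_minus; now apply is_derive_primitive. }
  destruct (MVT_gen (fun t => RInt f 0 t - RInt g 0 t) 0 t
    (fun s => f s - g s)) as [c [_ E]].
  - intros s _. apply Hd.
  - intros s _. apply derivable_continuous_pt. eexists.
    apply is_derive_Reals, Hd.
  - rewrite !RInt_point in E. change (@zero R_NormedModule) with 0 in E.
    change (@zero R_CompleteNormedModule) with 0 in E.
    replace (RInt f 0 t - RInt g 0 t) with ((f c - g c) * (t - 0)) by lra.
    rewrite Rminus_0_r, Rabs_mult.
    apply Rmult_le_compat_r; [apply Rabs_pos | apply H].
Qed.

(* Variation of constants: the solution with zero initial data of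
   [J''' + 4 J' = f] is [J t = int_0^t (1 - cos (2 (t - s))) / 4 * f s ds];
   expanding the cosine separates [t] from [s]. *)
Definition duhamel (f : R -> R) (t : R) : R :=
  (RInt f 0 t - cos (2 * t) * RInt (fun s => cos (2 * s) * f s) 0 t
   - sin (2 * t) * RInt (fun s => sin (2 * s) * f s) 0 t) / 4.

Definition duhamel1 (f : R -> R) (t : R) : R :=
  (sin (2 * t) * RInt (fun s => cos (2 * s) * f s) 0 t
   - cos (2 * t) * RInt (fun s => sin (2 * s) * f s) 0 t) / 2.

Definition duhamel2 (f : R -> R) (t : R) : R :=
  cos (2 * t) * RInt (fun s => cos (2 * s) * f s) 0 t
  + sin (2 * t) * RInt (fun s => sin (2 * s) * f s) 0 t.

Lemma continuity_cos2 (f : R -> R) :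
  continuity f -> continuity (fun s => cos (2 * s) * f s).
Proof.
  intros Hf. apply continuity_mult; [|exact Hf].
  apply (continuity_comp (fun s => 2 * s) cos); [|apply continuity_cos].
  intros x. reg.
Qed.

Lemma continuity_sin2 (f : R -> R) :
  continuity f -> continuity (fun s => sin (2 * s) * f s).
Proof.
  intros Hf. apply continuity_mult; [|exact Hf].
  apply (continuity_comp (fun s => 2 * s) sin); [|apply continuity_sin].
  intros x. reg.
Qed.

Lemma cos_sin_sqr (x : R) : cos x * cos x = 1 - sin x * sin x.
Proof. exact (cos2 x). Qed.

(** The terms with [f t] that come from differentiating the integrals cancel in the first two
    derivatives and add up to [f t] in the third, by [cos ^ 2 + sin ^ 2 = 1]. *)
Lemma is_derive_duhamel (f : R -> R) (t : R) :
  continuity f ->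
  is_derive (duhamel f) t (duhamel1 f t) /\
  is_derive (duhamel1 f) t (duhamel2 f t) /\
  is_derive (duhamel2 f) t (f t - 4 * duhamel1 f t).
Proof.
  intros Hf.
  assert (D0 := is_derive_primitive f t Hf).
  assert (Dc := is_derive_primitive _ t (continuity_cos2 f Hf)).
  assert (Ds := is_derive_primitive _ t (continuity_sin2 f Hf)).
  assert (E := cos_sin_sqr (2 * t)).
  unfold duhamel, duhamel1, duhamel2.
  set (I0 := fun t => RInt f 0 t) in *.
  set (Ic := fun t => RInt (fun s => cos (2 * s) * f s) 0 t) in *.
  set (Is := fun t => RInt (fun s => sin (2 * s) * f s) 0 t) in *.
  change (is_derive (fun t => (I0 t - cos (2 * t) * Ic t - sin (2 * t) * Is t) / 4) t
     ((sin (2 * t) * Ic t - cos (2 * t) * Is t) / 2) /\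
   is_derive (fun t => (sin (2 * t) * Ic t - cos (2 * t) * Is t) / 2) t
     (cos (2 * t) * Ic t + sin (2 * t) * Is t) /\
   is_derive (fun t => cos (2 * t) * Ic t + sin (2 * t) * Is t) t
     (f t - 4 * ((sin (2 * t) * Ic t - cos (2 * t) * Is t) / 2))).
  cbv beta in D0, Dc, Ds.
  (* The integrals become abstract functions with known derivatives, so that [auto_derive] does not
     look inside them. *)
  clearbody I0 Ic Is.
  split; [|split]; (auto_derive; [repeat split; eexists; eassumption|]);
    rw_derive Dc; rw_derive Ds; try rw_derive D0; field [E].
Qed.

(** Each of the three integrals contributes at most [M * Rabs t], and the division by 4 absorbs the
    factor 3. *)
Lemma duhamel_dist (f g : R -> R) (M t : R) :
  continuity f -> continuity g -> (forall s, Rabs (f s - g s) <= M) ->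
  Rabs (duhamel f t - duhamel g t) <= M * Rabs t.
Proof.
  intros Hf Hg H.
  assert (K : forall c x y, Rabs c <= 1 -> Rabs (x - y) <= M * Rabs t ->
    Rabs (c * x - c * y) <= M * Rabs t).
  { intros c x y Hc Hx. rewrite <- Rmult_minus_distr_l, Rabs_mult.
    assert (H1 := Rabs_pos (x - y)). nra. }
  assert (Hcos : forall x, Rabs (cos x) <= 1)
    by (intros x; apply Rabs_le, COS_bound).
  assert (Hsin : forall x, Rabs (sin x) <= 1)
    by (intros x; apply Rabs_le, SIN_bound).
  assert (K' : forall c x y, Rabs c <= 1 -> Rabs (x - y) <= M ->
    Rabs (c * x - c * y) <= M).
  { intros c x y Hc Hx. rewrite <- Rmult_minus_distr_l, Rabs_mult.
    assert (H1 := Rabs_pos (x - y)). nra. }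
  assert (H0 := primitive_dist f g M t Hf Hg H).
  assert (Hc := K (cos (2 * t)) _ _ (Hcos _) (primitive_dist _ _ M t
    (continuity_cos2 f Hf) (continuity_cos2 g Hg)
    (fun s => K' (cos (2 * s)) _ _ (Hcos _) (H s)))).
  assert (Hs := K (sin (2 * t)) _ _ (Hsin _) (primitive_dist _ _ M t
    (continuity_sin2 f Hf) (continuity_sin2 g Hg)
    (fun s => K' (sin (2 * s)) _ _ (Hsin _) (H s)))).
  assert (Hp : 0 <= M * Rabs t) by (apply Rle_trans with (2 := H0), Rabs_pos).
  unfold duhamel. apply Rabs_le_between in H0, Hc, Hs. apply Rabs_le. lra.
Qed.

(** * Uniqueness and maximality *)

Lemma in_interval_open (a b : Rbar) (t : R) :
  in_interval a b t -> locally t (in_interval a b).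
Proof. intros [Ha Hb]. exact (open_and _ _ (open_Rbar_gt a) (open_Rbar_lt b) t (conj Ha Hb)). Qed.

Lemma in_interval_between (a b : Rbar) (t s : R) :
  in_interval a b 0 -> in_interval a b t -> Rmin 0 t <= s <= Rmax 0 t ->
  in_interval a b s.
Proof.
  unfold in_interval, Rmin, Rmax. intros H0 Ht Hs.
  destruct (Rle_dec 0 t); destruct a as [a| |], b as [b| |]; simpl in *;
    intuition lra.
Qed.

Lemma is_derive_Derive_n (y : R -> R) (n : nat) (t : R) :
  ex_derive_n y (S n) t -> is_derive (Derive_n y n) t (Derive_n y (S n) t).
Proof. intros H. now apply Derive_correct. Qed.

(** The derivatives are known only inside the interval, so each identity between [Derive_n] and [y1]
    or [y2] is first spread over a neighbourhood, using openness, before it is differentiated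
    again. *)
Lemma solution_of_system (y0 eps : R) (a b : Rbar) (y y1 y2 : R -> R) :
  in_interval a b 0 -> y 0 = y0 -> y1 0 = 0 -> y2 0 = 0 ->
  (forall t, in_interval a b t ->
     0 < y t /\ is_derive y t (y1 t) /\ is_derive y1 t (y2 t) /\
     is_derive y2 t (eps * cos t * Rpower (y t) (- (5 / 2)) - 4 * y1 t)) ->
  is_solution y0 eps a b y.
Proof.
  intros H0 E0 E1 E2 H.
  assert (D1 : forall t, in_interval a b t -> Derive_n y 1 t = y1 t).
  { intros t Ht. apply is_derive_unique, H, Ht. }
  assert (L1 : forall t, in_interval a b t ->
    locally t (fun s => y1 s = Derive_n y 1 s)).
  { intros t Ht. apply filter_imp with (2 := in_interval_open a b t Ht).
    intros s Hs. symmetry. now apply D1. }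
  assert (I2 : forall t, in_interval a b t -> is_derive (Derive_n y 1) t (y2 t)).
  { intros t Ht. apply is_derive_ext_loc with (1 := L1 t Ht), H, Ht. }
  assert (D2 : forall t, in_interval a b t -> Derive_n y 2 t = y2 t).
  { intros t Ht. exact (is_derive_unique _ _ _ (I2 t Ht)). }
  assert (I3 : forall t, in_interval a b t -> is_derive (Derive_n y 2) t
    (eps * cos t * Rpower (y t) (- (5 / 2)) - 4 * y1 t)).
  { intros t Ht. apply is_derive_ext_loc with (f := y2); [|apply H, Ht].
    apply filter_imp with (2 := in_interval_open a b t Ht).
    intros s Hs. symmetry. now apply D2. }
  split; [exact H0|]. split.
  - intros t Ht. split; [apply H, Ht|]. split.
    + intros [|[|[|[|n]]]] Hn; [exact I| | | |lia].
      * exists (y1 t). apply H, Ht.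
      * exists (y2 t). apply (I2 t Ht).
      * eexists. exact (I3 t Ht).
    + rewrite (is_derive_unique _ _ _ (I3 t Ht) : Derive_n y 3 t = _).
      rewrite (D1 t Ht : Derive y t = _). ring.
  - split; [exact E0|]. split.
    + now rewrite (D1 0 H0 : Derive y 0 = _).
    + now rewrite D2.
Qed.

Lemma system_of_solution (y0 eps : R) (a b : Rbar) (y : R -> R) (t : R) :
  is_solution y0 eps a b y -> in_interval a b t ->
  is_derive y t (Derive y t) /\
  is_derive (Derive y) t (Derive_n y 2 t) /\
  is_derive (Derive_n y 2) t
    (eps * cos t * Rpower (y t) (- (5 / 2)) - 4 * Derive y t).
Proof.
  intros [_ [H _]] Ht. destruct (H t Ht) as [_ [Hd He]].
  split; [|split].
  - apply (is_derive_Derive_n y 0), Hd. lia.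
  - apply (is_derive_Derive_n y 1), Hd. lia.
  - replace (_ - 4 * Derive y t) with (Derive_n y 3 t) by (rewrite <- He; ring).
    apply (is_derive_Derive_n y 2), Hd. lia.
Qed.

(** On the compact segment between 0 and [t] both solutions have a positive minimum, above which the
    nonlinearity is Lipschitz; [stability] with [d = 0] then forces them to agree. *)
Lemma solution_unique (y0 eps : R) (a b a' b' : Rbar) (y u : R -> R) (t : R) :
  is_solution y0 eps a b y -> is_solution y0 eps a' b' u ->
  in_interval a b t -> in_interval a' b' t -> u t = y t.
Proof.
  intros Hy Hu Ht Ht'.
  assert (By : forall s, Rmin 0 t <= s <= Rmax 0 t -> in_interval a b s).
  { intros s. apply in_interval_between; [apply Hy | exact Ht]. }
  assert (Bu : forall s, Rmin 0 t <= s <= Rmax 0 t -> in_interval a' b' s).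
  { intros s. apply in_interval_between; [apply Hu | exact Ht']. }
  assert (Hpos : forall z a b, is_solution y0 eps a b z ->
    (forall s, Rmin 0 t <= s <= Rmax 0 t -> in_interval a b s) ->
    exists c, 0 < c /\ forall s, Rmin 0 t <= s <= Rmax 0 t -> c <= z s).
  { clear. intros z a b Hz B.
    destruct (continuity_ab_min z (Rmin 0 t) (Rmax 0 t)) as [m [Hm Im]].
    - apply Rle_trans with 0; [apply Rmin_l | apply Rmax_l].
    - intros s Hs. apply derivable_continuous_pt.
      exists (Derive z s). apply is_derive_Reals.
      exact (proj1 (system_of_solution _ _ _ _ _ _ Hz (B s Hs))).
    - exists (z m). split; [apply Hz, B, Im | exact Hm]. }
  destruct (Hpos _ _ _ Hy By) as [c [Hc Cy]].
  destruct (Hpos _ _ _ Hu Bu) as [c' [Hc' Cu]].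
  set (m := Rmin c c'). assert (Hm : 0 < m) by now apply Rmin_glb_lt.
  set (K := Rabs (- (5 / 2)) * Rpower m (- (5 / 2) - 1)).
  assert (HK : 0 <= K).
  { apply Rmult_le_pos; [apply Rabs_pos | left; apply exp_pos]. }
  assert (S := stability (fun s => u s - y s)
    (fun s => Derive u s - Derive y s)
    (fun s => Derive_n u 2 s - Derive_n y 2 s)
    (fun s => (eps * cos s * Rpower (u s) (- (5 / 2)) - 4 * Derive u s)
       - (eps * cos s * Rpower (y s) (- (5 / 2)) - 4 * Derive y s))
    (Rabs eps * K) 0 t).
  destruct (proj2 (proj2 Hy)) as (Y0 & Y1 & Y2).
  destruct (proj2 (proj2 Hu)) as (U0 & U1 & U2).
  cbv beta in S. rewrite Y0, Y1, Y2, U0, U1, U2, !Rminus_diag in S.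
  rewrite Rmult_0_l in S.
  apply Rminus_diag_uniq.
  apply Rabs_eq_0, Rle_antisym; [apply S; try reflexivity | apply Rabs_pos].
  - apply Rmult_le_pos; [apply Rabs_pos | exact HK].
  - intros s Hs.
    destruct (system_of_solution _ _ _ _ _ _ Hy (By s Hs)) as (A0 & A1 & A2).
    destruct (system_of_solution _ _ _ _ _ _ Hu (Bu s Hs)) as (B0 & B1 & B2).
    split; [|split; [|split]]; try now apply @is_derive_minus.
    replace (_ - _ - _ + _) with
      (eps * (cos s * (Rpower (u s) (- (5 / 2)) - Rpower (y s) (- (5 / 2)))))
      by ring.
    rewrite Rplus_0_r, !Rabs_mult, Rmult_assoc.
    apply Rmult_le_compat_l; [apply Rabs_pos|].
    rewrite <- (Rmult_1_l (K * _)).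
    apply Rmult_le_compat; try apply Rabs_pos.
    + apply Rabs_le, COS_bound.
    + apply Rpower_lipschitz; [exact Hm | lra | |].
      * apply Rle_trans with (1 := Rmin_r c c'), Cu, Hs.
      * apply Rle_trans with (1 := Rmin_l c c'), Cy, Hs.
Qed.

Lemma solution_ext_loc (eps : R) (y z : R -> R) (t : R) :
  locally t (fun s => y s = z s) ->
  0 < y t /\
  (forall n : nat, (n <= 3)%nat -> ex_derive_n y n t) /\
  Derive_n y 3 t + 4 * Derive y t = eps * cos t * Rpower (y t) (- (5 / 2)) ->
  0 < z t /\
  (forall n : nat, (n <= 3)%nat -> ex_derive_n z n t) /\
  Derive_n z 3 t + 4 * Derive z t = eps * cos t * Rpower (z t) (- (5 / 2)).
Proof.
  intros L (P & D & E).
  rewrite <- (locally_singleton _ _ L).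
  rewrite <- (Derive_n_ext_loc _ _ 3 t L), <- (Derive_ext_loc _ _ t L).
  split; [exact P|]. split; [|exact E].
  intros n Hn. apply ex_derive_n_ext_loc with (1 := L). now apply D.
Qed.

Lemma in_interval_dec (a b : Rbar) (t : R) :
  {in_interval a b t} + {~ in_interval a b t}.
Proof.
  unfold in_interval. destruct (Rbar_lt_dec a t), (Rbar_lt_dec t b); tauto.
Qed.

(** Near a point of [(a1, b1)] the glued function is [u], even where the branch [y] is taken, by
    uniqueness. So it locally coincides with one of the two solutions everywhere. *)
Lemma solution_glue (y0 eps : R) (a b a1 b1 a' b' : Rbar) (y u : R -> R) :
  is_solution y0 eps a b y -> is_solution y0 eps a1 b1 u ->
  in_interval a' b' 0 ->
  (forall t, in_interval a' b' t -> in_interval a b t \/ in_interval a1 b1 t) ->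
  is_solution y0 eps a' b'
    (fun t => if in_interval_dec a b t then y t else u t).
Proof.
  intros Hy Hu H0 Hcover.
  set (z := fun t => if in_interval_dec a b t then y t else u t).
  assert (Zy : forall t, in_interval a b t -> locally t (fun s => y s = z s)).
  { intros t Ht. apply filter_imp with (2 := in_interval_open a b t Ht).
    intros s Hs. unfold z. now destruct in_interval_dec. }
  assert (Zu : forall t, in_interval a1 b1 t -> locally t (fun s => u s = z s)).
  { intros t Ht. apply filter_imp with (2 := in_interval_open a1 b1 t Ht).
    intros s Hs. unfold z. destruct in_interval_dec; [|reflexivity].
    now apply (solution_unique y0 eps a b a1 b1). }
  split; [exact H0|]. split.
  - intros t Ht. destruct (Hcover t Ht) as [Hi | Hi].
    + apply solution_ext_loc with (1 := Zy t Hi), Hy, Hi.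
    + apply solution_ext_loc with (1 := Zu t Hi), Hu, Hi.
  - destruct Hy as [Hi [_ (E0 & E1 & E2)]].
    assert (L := Zy 0 Hi).
    rewrite <- (Derive_n_ext_loc _ _ 2 0 L), <- (Derive_ext_loc _ _ 0 L).
    rewrite <- (locally_singleton _ _ L). auto.
Qed.

Lemma maximal_solution_contains (y0 eps : R) (a b a1 b1 : Rbar) (y u : R -> R) (t : R) :
  is_maximal_solution y0 eps a b y -> is_solution y0 eps a1 b1 u ->
  in_interval a1 b1 t -> in_interval a b t.
Proof.
  intros [Hy Hmax] Hu Ht.
  assert (Hy0 := proj1 Hy). assert (Hu0 := proj1 Hu).
  assert (Hglue := fun a' b' => solution_glue y0 eps a b a1 b1 a' b' y u Hy Hu).
  assert (Hext : forall s, in_interval a b s ->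
    (if in_interval_dec a b s then y s else u s) = y s).
  { intros s Hs. now destruct in_interval_dec. }
  destruct Hy0 as [Ha0 Hb0], Hu0 as [Ha1 Hb1], Ht as [Hta Htb].
  split; apply Rbar_not_le_lt; intros Hle.
  - assert (Hlt := Rbar_lt_le_trans _ _ _ Hta Hle).
    (* Only the left endpoint is moved here, and the right one in the second case. There is no gap,
       because both intervals contain 0: a point [s <= a] satisfies [s < 0 < b1]. *)
    assert (Hcover : forall s, in_interval a1 b s ->
      in_interval a b s \/ in_interval a1 b1 s).
    { intros s [Hs Hs'].
      destruct (Rbar_lt_dec a s) as [H|H]; [left; split; assumption|].
      right. split; [exact Hs|].
      apply Rbar_le_lt_trans with a; [apply Rbar_not_lt_le; assumption|].
      apply Rbar_lt_trans with 0; assumption. }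
    destruct (Hmax _ _ _ (Hglue a1 b (conj Ha1 Hb0) Hcover)) as [E _].
    + apply Rbar_lt_le; assumption.
    + apply Rbar_le_refl.
    + exact Hext.
    + rewrite E in Hlt. exact (Rbar_lt_not_eq _ _ Hlt eq_refl).
  - assert (Hlt := Rbar_le_lt_trans _ _ _ Hle Htb).
    assert (Hcover : forall s, in_interval a b1 s ->
      in_interval a b s \/ in_interval a1 b1 s).
    { intros s [Hs Hs'].
      destruct (Rbar_lt_dec s b) as [H|H]; [left; split; assumption|].
      right. split; [|exact Hs'].
      apply Rbar_lt_le_trans with b; [|apply Rbar_not_lt_le; assumption].
      apply Rbar_lt_trans with 0; assumption. }
    destruct (Hmax _ _ _ (Hglue a b1 (conj Ha0 Hb1) Hcover)) as [_ E].
    + apply Rbar_le_refl.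
    + apply Rbar_lt_le; assumption.
    + exact Hext.
    + rewrite E in Hlt. exact (Rbar_lt_not_eq _ _ Hlt eq_refl).
Qed.

(** * Existence for small [eps] *)

(** Precomposing with this projection onto [[- T, T]] turns bounds that grow like [Rabs t] into
    uniform bounds on the whole line, as [banach_fixed_point] requires. *)
Definition clamp (T t : R) : R := Rmax (- T) (Rmin T t).

Lemma clamp_lipschitz (T x y : R) : Rabs (clamp T x - clamp T y) <= 1 * Rabs (x - y).
Proof.
  assert (H := Rle_abs (x - y)). assert (H' := Rle_abs (- (x - y))).
  rewrite Rabs_Ropp in H'. apply Rabs_le.
  unfold clamp, Rmin. destruct (Rle_dec T x), (Rle_dec T y);
    unfold Rmax; repeat destruct Rle_dec; lra.
Qed.

Lemma clamp_id (T t : R) : - T < t < T -> clamp T t = t.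
Proof. intros H. unfold clamp. now rewrite Rmin_right, Rmax_right by lra. Qed.

Lemma clamp_bound (T t : R) : 0 < T -> Rabs (clamp T t) <= T.
Proof.
  intros HT. apply Rabs_le. unfold clamp, Rmin.
  destruct (Rle_dec T t); unfold Rmax; destruct Rle_dec; lra.
Qed.

(* Picard iteration on [-T, T] for the nonlinearity frozen below [y0 / 2], which
   is bounded and globally Lipschitz; for small [eps] the fixed point stays
   above [y0 / 2], where the truncation is inactive. *)
Lemma solution_exists (y0 T : R) :
  0 < y0 -> 0 < T ->
  exists e0, 0 < e0 /\ forall eps, Rabs eps < e0 ->
  exists u, is_solution y0 eps (- T) T u /\
    forall t, - T < t < T -> y0 / 2 <= u t.
Proof.
  intros Hy0 HT.
  set (c := y0 / 2). assert (Hc : 0 < c) by (unfold c; lra).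
  set (G := fun z => Rpower (Rmax z c) (- (5 / 2))).
  set (M := Rpower c (- (5 / 2))). assert (HM : 0 < M) by apply exp_pos.
  set (L := Rabs (- (5 / 2)) * Rpower c (- (5 / 2) - 1)).
  assert (HL : 0 <= L).
  { apply Rmult_le_pos; [apply Rabs_pos | left; apply exp_pos]. }
  assert (HG : forall z z', Rabs (G z - G z') <= L * Rabs (z - z')).
  { intros z z'. unfold G.
    apply Rle_trans with (L * Rabs (Rmax z c - Rmax z' c)).
    - apply Rpower_lipschitz; try apply Rmax_r; lra.
    - apply Rmult_le_compat_l; [exact HL|].
      assert (H := Rle_abs (z - z')). assert (H' := Rle_abs (- (z - z'))).
      rewrite Rabs_Ropp in H'. apply Rabs_le.
      unfold Rmax. repeat destruct Rle_dec; lra. }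
  assert (HGM : forall z, Rabs (G z) <= M).
  { intros z. rewrite Rabs_pos_eq by (left; apply exp_pos).
    apply Rpower_decr; [|lra]. split; [exact Hc | apply Rmax_r]. }
  assert (HGc := lipschitz_continuity G L HG).
  set (F := fun (u : R -> R) s => cos s * G (u s)).
  assert (HF : forall u, continuity u -> continuity (F u)).
  { intros u Hu. apply continuity_mult; [apply continuity_cos|].
    now apply (continuity_comp u G). }
  set (A := fun eps (u : R -> R) t => y0 + eps * duhamel (F u) (clamp T t)).
  (* The first bound makes [A eps] a contraction of ratio [1 / 2]; the second keeps its values
     within [c = y0 / 2] of [y0]. Writing [L + 1] ensures a positive denominator. *)
  set (e0 := Rmin (/ (2 * (T * (L + 1)))) (c / (T * M))).
  assert (HTL : 0 < T * (L + 1)) by (apply Rmult_lt_0_compat; lra).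
  assert (HTM : 0 < T * M) by now apply Rmult_lt_0_compat.
  exists e0. split.
  { apply Rmin_glb_lt; [apply Rinv_0_lt_compat | apply Rdiv_lt_0_compat]; lra. }
  intros eps Heps.
  assert (Hq : Rabs eps * (T * (L + 1)) <= 1 / 2).
  { apply Rle_trans with (/ (2 * (T * (L + 1))) * (T * (L + 1))).
    - apply Rmult_le_compat_r; [lra|].
      apply Rle_trans with e0; [lra | apply Rmin_l].
    - right. field. split; lra. }
  assert (HqM : Rabs eps * (T * M) <= c).
  { apply Rle_trans with (c / (T * M) * (T * M)).
    - apply Rmult_le_compat_r; [lra|].
      apply Rle_trans with e0; [lra | apply Rmin_r].
    - right. field. split; lra. }
  assert (Hcos : forall s, Rabs (cos s) <= 1)
    by (intros s; apply Rabs_le, COS_bound).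
  assert (HAlip : forall u v m, continuity u -> continuity v ->
    (forall s, Rabs (u s - v s) <= m) ->
    forall t, Rabs (A eps u t - A eps v t) <= 1 / 2 * m).
  { intros u v m Hu Hv Huv t.
    assert (Hm : 0 <= m) by (apply Rle_trans with (2 := Huv 0), Rabs_pos).
    assert (HD := duhamel_dist (F u) (F v) (L * m) (clamp T t) (HF u Hu) (HF v Hv)).
    unfold A.
    replace (_ - _) with
      (eps * (duhamel (F u) (clamp T t) - duhamel (F v) (clamp T t))) by ring.
    rewrite Rabs_mult.
    apply Rle_trans with (Rabs eps * (L * m * T)).
    - apply Rmult_le_compat_l; [apply Rabs_pos|].
      apply Rle_trans with (L * m * Rabs (clamp T t)).
      + apply HD. intros s. unfold F.
        rewrite <- Rmult_minus_distr_l, Rabs_mult.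
        rewrite <- (Rmult_1_l (L * m)).
        apply Rmult_le_compat; try apply Rabs_pos; [apply Hcos|].
        apply Rle_trans with (1 := HG _ _).
        now apply Rmult_le_compat_l.
      + apply Rmult_le_compat_l; [now apply Rmult_le_pos | now apply clamp_bound].
    - apply Rle_trans with (Rabs eps * (T * (L + 1)) * m).
      + assert (He := Rabs_pos eps).
        assert (0 <= Rabs eps * (T * m)).
        { apply Rmult_le_pos; [exact He | apply Rmult_le_pos; lra]. }
        lra.
      + now apply Rmult_le_compat_r. }
  assert (HAM : forall u, continuity u -> forall t, Rabs (A eps u t - y0) <= c).
  { intros u Hu t.
    (* Comparison with the zero forcing turns [duhamel_dist] into a bound on the size of
       [duhamel (F u)]. *)
    assert (H0 : continuity (fun _ => 0)) by (intros x; reg).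
    assert (HD := duhamel_dist (F u) (fun _ => 0) M (clamp T t) (HF u Hu) H0).
    assert (Z : duhamel (fun _ => 0) (clamp T t) = 0).
    { assert (E : forall g : R -> R, RInt (fun s => g s * 0) 0 (clamp T t) = 0).
      { intros g. rewrite (RInt_ext _ (fun _ => 0)) by (intros x _; apply Rmult_0_r).
        rewrite RInt_const. apply Rmult_0_r. }
      unfold duhamel. rewrite !E, RInt_const. unfold scal; simpl; unfold mult; simpl.
      field. }
    rewrite Z, Rminus_0_r in HD.
    unfold A. replace (_ - _) with (eps * duhamel (F u) (clamp T t)) by ring.
    rewrite Rabs_mult. apply Rle_trans with (2 := HqM).
    apply Rmult_le_compat_l; [apply Rabs_pos|].
    apply Rle_trans with (M * Rabs (clamp T t)).
    - apply HD. intros s. unfold F. rewrite Rminus_0_r, Rabs_mult.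
      rewrite <- (Rmult_1_l M).
      apply Rmult_le_compat; try apply Rabs_pos; [apply Hcos | apply HGM].
    - rewrite (Rmult_comm T). apply Rmult_le_compat_l; [lra | now apply clamp_bound]. }
  (* The iteration starts at the constant [y0], so the first step has size at most [c] by [HAM]. *)
  destruct (banach_fixed_point (A eps) (1 / 2) c (fun _ => y0)) as [u [Hu Hfix]].
  - lra.
  - intros x. reg.
  - intros u Hu t.
    apply (continuity_plus (fun _ => y0) (fun t => eps * duhamel (F u) (clamp T t)));
      [intros x; reg|].
    apply (continuity_scal (fun t => duhamel (F u) (clamp T t))).
    apply (continuity_comp (clamp T) (duhamel (F u))).
    + apply lipschitz_continuity with 1, clamp_lipschitz.
    + intros x. apply derivable_continuous_pt. exists (duhamel1 (F u) x).
      apply is_derive_Reals. exact (proj1 (is_derive_duhamel (F u) x (HF u Hu))).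
  - exact HAlip.
  - apply HAM. intros x. reg.
  - exists u.
    assert (Hlow : forall t, c <= u t).
    { intros t. assert (H := HAM u Hu t). rewrite Hfix in H.
      apply Rabs_le_between in H. unfold c in *. lra. }
    assert (Heq : forall t, - T < t < T -> u t = y0 + eps * duhamel (F u) t).
    { intros t Ht. rewrite <- (Hfix t) at 1. unfold A. now rewrite clamp_id. }
    assert (H0 : in_interval (- T) T 0) by (split; simpl; lra).
    assert (Z : duhamel (F u) 0 = 0 /\ duhamel1 (F u) 0 = 0 /\ duhamel2 (F u) 0 = 0).
    { unfold duhamel, duhamel1, duhamel2. rewrite !RInt_point.
      change (@zero R_CompleteNormedModule) with 0. repeat split; field. }
    destruct Z as (Z0 & Z1 & Z2).
    split; [|intros t _; apply Hlow].
    apply solution_of_system with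
      (y1 := fun t => eps * duhamel1 (F u) t) (y2 := fun t => eps * duhamel2 (F u) t).
    + exact H0.
    + rewrite Heq by lra. rewrite Z0. ring.
    + rewrite Z1. ring.
    + rewrite Z2. ring.
    + intros t Ht.
      destruct (is_derive_duhamel (F u) t (HF u Hu)) as (D0 & D1 & D2).
      split; [|split; [|split]].
      * now apply Rlt_le_trans with c.
      * apply is_derive_ext_loc with (fun t => y0 + eps * duhamel (F u) t).
        { apply filter_imp with (2 := in_interval_open _ _ t Ht).
          intros s Hs. symmetry. now apply Heq. }
        replace (eps * duhamel1 (F u) t) with (0 + eps * duhamel1 (F u) t) by ring.
        apply @is_derive_plus; [apply @is_derive_const | now apply is_derive_scal].
      * now apply is_derive_scal.
      * replace (_ - _) with (eps * (F u t - 4 * duhamel1 (F u) t)).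
        { now apply is_derive_scal. }
        unfold F, G. rewrite Rmax_left by apply Hlow. ring.
Qed.

(** * The formal expansion *)

(** The Chebyshev form, a polynomial in [cos t] possibly times [sin t]. After this rewriting,
    trigonometric identities are polynomial ones modulo the single relation
    [sin ^ 2 = 1 - cos ^ 2]. *)
Lemma sin_cos_multiples (t : R) :
  sin (2 * t) = sin t * (2 * cos t) /\
  cos (2 * t) = 2 * cos t ^ 2 - 1 /\
  sin (3 * t) = sin t * (4 * cos t ^ 2 - 1) /\
  cos (3 * t) = 4 * cos t ^ 3 - 3 * cos t /\
  sin (4 * t) = sin t * (8 * cos t ^ 3 - 4 * cos t) /\
  cos (4 * t) = 8 * cos t ^ 4 - 8 * cos t ^ 2 + 1 /\
  sin (5 * t) = sin t * (16 * cos t ^ 4 - 12 * cos t ^ 2 + 1) /\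
  cos (5 * t) = 16 * cos t ^ 5 - 20 * cos t ^ 3 + 5 * cos t /\
  sin (6 * t) = sin t * (32 * cos t ^ 5 - 32 * cos t ^ 3 + 6 * cos t) /\
  cos (6 * t) = 32 * cos t ^ 6 - 48 * cos t ^ 4 + 18 * cos t ^ 2 - 1.
Proof.
  assert (Hs : sin t * sin t = 1 - cos t * cos t)
    by (rewrite cos_sin_sqr; ring).
  assert (next : forall k sk ck, sin (k * t) = sk -> cos (k * t) = ck ->
    sin ((k + 1) * t) = sk * cos t + ck * sin t /\
    cos ((k + 1) * t) = ck * cos t - sk * sin t).
  { intros k sk ck <- <-.
    rewrite Rmult_plus_distr_r, Rmult_1_l, sin_plus, cos_plus. now split. }
  assert (S1 : sin (1 * t) = sin t) by now rewrite Rmult_1_l.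
  assert (C1 : cos (1 * t) = cos t) by now rewrite Rmult_1_l.
  destruct (next 1 _ _ S1 C1) as [S2 C2].
  replace (1 + 1) with 2 in S2, C2 by ring.
  destruct (next 2 _ _ S2 C2) as [S3 C3].
  replace (2 + 1) with 3 in S3, C3 by ring.
  destruct (next 3 _ _ S3 C3) as [S4 C4].
  replace (3 + 1) with 4 in S4, C4 by ring.
  destruct (next 4 _ _ S4 C4) as [S5 C5].
  replace (4 + 1) with 5 in S5, C5 by ring.
  destruct (next 5 _ _ S5 C5) as [S6 C6].
  replace (5 + 1) with 6 in S6, C6 by ring.
  rewrite S2, C2, S3, C3, S4, C4, S5, C5, S6, C6.
  repeat split; ring [Hs].
Qed.

(* [rho_k = y0 ^ (- 7 k / 2) * p_k]; [q_k] and [r_k] are the first and second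
   derivatives of [p_k]. *)
Definition p1 (t : R) : R := 1 / 3 * sin t - 1 / 6 * sin (2 * t).
Definition q1 (t : R) : R := 1 / 3 * cos t - 1 / 3 * cos (2 * t).
Definition r1 (t : R) : R := - (1 / 3) * sin t + 2 / 3 * sin (2 * t).

Definition p2 (t : R) : R :=
  - (5 / 288) - 1 / 24 * cos t + 19 / 288 * cos (2 * t) - 1 / 72 * cos (3 * t)
  + 1 / 144 * cos (4 * t) + 5 / 96 * t * sin (2 * t).
Definition q2 (t : R) : R :=
  5 / 48 * t * cos (2 * t) + 1 / 24 * sin t - 23 / 288 * sin (2 * t)
  + 1 / 24 * sin (3 * t) - 1 / 36 * sin (4 * t).
Definition r2 (t : R) : R :=
  - (5 / 24) * t * sin (2 * t) + 1 / 24 * cos t - 1 / 18 * cos (2 * t)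
  + 1 / 8 * cos (3 * t) - 1 / 9 * cos (4 * t).

Definition p3 (t : R) : R :=
  (- (45 / 4) * t + 135 / 4 * t * cos t - 45 / 2 * t * cos (2 * t)
   + 45 / 4 * t * cos (3 * t) - 45 / 4 * t * cos (4 * t)
   + 159 / 2 * sin t - 327 / 4 * sin (2 * t) + 73 / 4 * sin (3 * t)
   + 69 / 8 * sin (4 * t) - 9 / 4 * sin (5 * t) + sin (6 * t)) / 2592.
Definition q3 (t : R) : R :=
  - (5 / 384) * t * sin t + 5 / 288 * t * sin (2 * t)
  - 5 / 384 * t * sin (3 * t) + 5 / 288 * t * sin (4 * t)
  - 5 / 1152 + 151 / 3456 * cos t - 31 / 432 * cos (2 * t)
  + 11 / 432 * cos (3 * t) + 31 / 3456 * cos (4 * t) - 5 / 1152 * cos (5 * t)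
  + 1 / 432 * cos (6 * t).
Definition r3 (t : R) : R :=
  - (5 / 384) * t * cos t + 5 / 144 * t * cos (2 * t)
  - 5 / 128 * t * cos (3 * t) + 5 / 72 * t * cos (4 * t)
  - 49 / 864 * sin t + 139 / 864 * sin (2 * t) - 103 / 1152 * sin (3 * t)
  - 1 / 54 * sin (4 * t) + 25 / 1152 * sin (5 * t) - 1 / 72 * sin (6 * t).

(* The order [eps ^ k] part of
   [P''' + 4 P' + 3 P' P'' + P' ^ 3 = eps cos t exp (- 7/2 P)], the equation
   satisfied by [P = ln y] when [y0 = 1]. *)
Definition s1 (t : R) : R := cos t - 4 * q1 t.
Definition s2 (t : R) : R :=
  - (7 / 2) * cos t * p1 t - 3 * q1 t * r1 t - 4 * q2 t.
Definition s3 (t : R) : R :=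
  cos t * (- (7 / 2) * p2 t + 49 / 8 * p1 t ^ 2)
  - 3 * (q1 t * r2 t + q2 t * r1 t) - q1 t ^ 3 - 4 * q3 t.

Lemma is_derive_p1 (t : R) : is_derive p1 t (q1 t).
Proof. unfold p1, q1. auto_derive; [exact I | field]. Qed.
Lemma is_derive_q1 (t : R) : is_derive q1 t (r1 t).
Proof. unfold q1, r1. auto_derive; [exact I | field]. Qed.
Lemma is_derive_p2 (t : R) : is_derive p2 t (q2 t).
Proof. unfold p2, q2. auto_derive; [exact I | field]. Qed.
Lemma is_derive_q2 (t : R) : is_derive q2 t (r2 t).
Proof. unfold q2, r2. auto_derive; [exact I | field]. Qed.
Lemma is_derive_p3 (t : R) : is_derive p3 t (q3 t).
Proof. unfold p3, q3. auto_derive; [exact I | field]. Qed.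
Lemma is_derive_q3 (t : R) : is_derive q3 t (r3 t).
Proof. unfold q3, r3. auto_derive; [exact I | field]. Qed.

Ltac expand_multiples t :=
  let S2 := fresh in let C2 := fresh in let S3 := fresh in let C3 := fresh in
  let S4 := fresh in let C4 := fresh in let S5 := fresh in let C5 := fresh in
  let S6 := fresh in let C6 := fresh in
  destruct (sin_cos_multiples t) as (S2 & C2 & S3 & C3 & S4 & C4 & S5 & C5 & S6 & C6);
  rewrite ?S2, ?C2, ?S3, ?C3, ?S4, ?C4, ?S5, ?C5, ?S6, ?C6;
  clear S2 C2 S3 C3 S4 C4 S5 C5 S6 C6.

(** This lemma and the next two verify the coefficients: the directly computed third derivative of
    [p_k] equals the one that the order [k] equation prescribes. *)
Lemma is_derive_r1 (t : R) : is_derive r1 t (s1 t).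
Proof. unfold s1, q1, r1. auto_derive; [exact I | field]. Qed.
Lemma is_derive_r2 (t : R) : is_derive r2 t (s2 t).
Proof.
  assert (Hs : sin t * sin t = 1 - cos t * cos t)
    by (rewrite cos_sin_sqr; ring).
  unfold s2, p1, q1, q2, r1, r2. auto_derive; [exact I|].
  expand_multiples t. field [Hs].
Qed.
Lemma is_derive_r3 (t : R) : is_derive r3 t (s3 t).
Proof.
  assert (Hs : sin t * sin t = 1 - cos t * cos t)
    by (rewrite cos_sin_sqr; ring).
  unfold s3, p1, p2, q1, q2, q3, r1, r2, r3. auto_derive; [exact I|].
  expand_multiples t. field [Hs].
Qed.

Lemma pqr_at_0 :
  (p1 0 = 0 /\ q1 0 = 0 /\ r1 0 = 0) /\ (p2 0 = 0 /\ q2 0 = 0 /\ r2 0 = 0) /\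
  (p3 0 = 0 /\ q3 0 = 0 /\ r3 0 = 0).
Proof.
  unfold p1, q1, r1, p2, q2, r2, p3, q3, r3.
  rewrite !Rmult_0_r, sin_0, cos_0. repeat split; field.
Qed.

(** * Size of the residual of the truncated expansion *)

Lemma bounded_on_segment (f : R -> R) (T : R) :
  continuity f -> exists B, forall t, Rabs t <= T -> Rabs (f t) <= B.
Proof.
  intros Hf. destruct (Rle_dec 0 T) as [HT | HT].
  - destruct (continuity_ab_maj (fun t => Rabs (f t)) (- T) T) as [m [Hm _]].
    + lra.
    + intros c _. apply (continuity_pt_comp f Rabs); [apply Hf | apply Rcontinuity_abs].
    + exists (Rabs (f m)). intros t Ht. apply Hm. now apply Rabs_le_between.
  - exists 0. intros t Ht. assert (H := Rabs_pos t). lra.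
Qed.

(** The normalisation [1 <= B] later gives [Rabs e <= 1] from the smallness of [B * Rabs e]. *)
Lemma bounded_on_segment_list (l : list (R -> R)) (T : R) :
  (forall f, In f l -> continuity f) ->
  exists B, 1 <= B /\ forall f, In f l -> forall t, Rabs t <= T -> Rabs (f t) <= B.
Proof.
  induction l as [|g l IH]; intros H.
  - exists 1. split; [apply Rle_refl | intros f []].
  - destruct IH as [B [HB1 HB]]; [intros f Hf; apply H; now right|].
    destruct (bounded_on_segment g T) as [B' HB']; [apply H; now left|].
    exists (Rmax B B'). split; [apply Rle_trans with (1 := HB1), Rmax_l|].
    intros f [<- | Hf] t Ht.
    + apply Rle_trans with (1 := HB' t Ht), Rmax_r.
    + apply Rle_trans with (1 := HB f Hf t Ht), Rmax_l.
Qed.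

(** Three nested mean value steps: each function vanishes at 0 and has the next one as its
    derivative. The remainder becomes [exp g * d * c * x] with [c], [d], [g] no larger than [x] in
    absolute value, and [exp g <= exp 1 <= 3]. *)
Lemma exp_taylor2 (x : R) :
  Rabs x <= 1 -> Rabs (exp x - 1 - x - x * x / 2) <= 3 * Rabs x ^ 3.
Proof.
  assert (MV : forall (f df : R -> R) z, f 0 = 0 ->
    (forall u, is_derive f u (df u)) ->
    exists c, f z = df c * z /\ Rabs c <= Rabs z).
  { intros f df z H0 Hd. destruct (MVT_cor4 f df 0 (Rabs z)) with z as [c [E Hc]].
    - intros c _. apply Hd.
    - rewrite Rminus_0_r. apply Rle_refl.
    - exists c. rewrite H0, !Rminus_0_r in *. now split. }
  intros Hx.
  destruct (MV (fun x => exp x - 1 - x - x * x / 2) (fun x => exp x - 1 - x) x)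
    as [c [-> Hc]].
  { rewrite exp_0. field. }
  { intros u. auto_derive; [exact I | field]. }
  destruct (MV (fun x => exp x - 1 - x) (fun x => exp x - 1) c) as [d [-> Hd]].
  { rewrite exp_0. field. }
  { intros u. auto_derive; [exact I | field]. }
  destruct (MV (fun x => exp x - 1) exp d) as [g [-> Hg]].
  { rewrite exp_0. field. }
  { intros u. auto_derive; [exact I | field]. }
  rewrite !Rabs_mult. simpl pow.
  assert (Hexp : Rabs (exp g) <= 3).
  { rewrite Rabs_pos_eq by (left; apply exp_pos).
    apply Rle_trans with (exp 1); [|apply exp_le_3].
    apply exp_monotone. apply Rle_trans with (1 := Rle_abs g). lra. }
  assert (Px := Rabs_pos x). assert (Pd := Rabs_pos d).
  assert (Pc := Rabs_pos c). assert (Pg := Rabs_pos (exp g)).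
  rewrite !Rmult_assoc, Rmult_1_r.
  repeat (apply Rmult_le_compat; try assumption;
    repeat apply Rmult_le_pos; try assumption); lra.
Qed.

Lemma Rabs_plus_le (x y a b : R) :
  Rabs x <= a -> Rabs y <= b -> Rabs (x + y) <= a + b.
Proof. intros Hx Hy. apply Rle_trans with (1 := Rabs_triang x y). lra. Qed.

Lemma Rabs_minus_le (x y a b : R) :
  Rabs x <= a -> Rabs y <= b -> Rabs (x - y) <= a + b.
Proof.
  intros Hx Hy. apply Rabs_plus_le; [exact Hx | now rewrite Rabs_Ropp].
Qed.

Lemma Rabs_mult_le (x y a b : R) :
  Rabs x <= a -> Rabs y <= b -> Rabs (x * y) <= a * b.
Proof.
  intros Hx Hy. rewrite Rabs_mult.
  apply Rmult_le_compat; try apply Rabs_pos; assumption.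
Qed.

Ltac bound_abs :=
  first [ eassumption
        | eapply Rabs_plus_le; [bound_abs | bound_abs]
        | eapply Rabs_minus_le; [bound_abs | bound_abs]
        | eapply Rabs_mult_le; [bound_abs | bound_abs]
        | apply Rle_refl ].

(* The coefficient of [e ^ 4] left over when
   [P = e p1 + e ^ 2 p2 + e ^ 3 p3] is inserted in the equation for [P], with the
   exponential replaced by its second order Taylor polynomial. *)
Definition tail4 (c e x1 x2 x3 d1 d2 d3 g1 g2 g3 : R) : R :=
  - (7 / 2) * c * x3
  + 49 / 8 * c * (2 * x1 * x2 + e * (2 * x1 * x3 + x2 * x2)
      + 2 * (e * e) * x2 * x3 + e * e * e * (x3 * x3))
  - 3 * (d1 * g3 + d2 * g2 + d3 * g1 + e * (d2 * g3 + d3 * g2) + e * e * (d3 * g3))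
  - (3 * d1 * d1 * (d2 + e * d3) + 3 * e * d1 * ((d2 + e * d3) * (d2 + e * d3))
      + e * e * ((d2 + e * d3) * (d2 + e * d3) * (d2 + e * d3))).

Lemma tail4_bound (B : R) :
  exists K, forall c e x1 x2 x3 d1 d2 d3 g1 g2 g3,
    Rabs c <= 1 -> Rabs e <= 1 ->
    Rabs x1 <= B -> Rabs x2 <= B -> Rabs x3 <= B ->
    Rabs d1 <= B -> Rabs d2 <= B -> Rabs d3 <= B ->
    Rabs g1 <= B -> Rabs g2 <= B -> Rabs g3 <= B ->
    Rabs (tail4 c e x1 x2 x3 d1 d2 d3 g1 g2 g3) <= K.
Proof.
  (* [K] is an existential variable created before the other variables; [bound_abs] follows the
     syntax of [tail4] and fills it with an expression in [B] alone. *)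
  eexists. intros. unfold tail4. bound_abs.
Qed.

Definition P0 (e t : R) : R := e * p1 t + e ^ 2 * p2 t + e ^ 3 * p3 t.
Definition P1 (e t : R) : R := e * q1 t + e ^ 2 * q2 t + e ^ 3 * q3 t.
Definition P2 (e t : R) : R := e * r1 t + e ^ 2 * r2 t + e ^ 3 * r3 t.
Definition P3 (e t : R) : R := e * s1 t + e ^ 2 * s2 t + e ^ 3 * s3 t.

Lemma is_derive_comb3 (f1 f2 f3 : R -> R) (e t l1 l2 l3 : R) :
  is_derive f1 t l1 -> is_derive f2 t l2 -> is_derive f3 t l3 ->
  is_derive (fun t => e * f1 t + e ^ 2 * f2 t + e ^ 3 * f3 t) t
    (e * l1 + e ^ 2 * l2 + e ^ 3 * l3).
Proof.
  intros H1 H2 H3. apply @is_derive_plus; [apply @is_derive_plus|];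
    now apply is_derive_scal.
Qed.

Lemma is_derive_P (e t : R) :
  is_derive (P0 e) t (P1 e t) /\ is_derive (P1 e) t (P2 e t) /\
  is_derive (P2 e) t (P3 e t).
Proof.
  split; [|split]; apply is_derive_comb3.
  - exact (is_derive_p1 t).
  - exact (is_derive_p2 t).
  - exact (is_derive_p3 t).
  - exact (is_derive_q1 t).
  - exact (is_derive_q2 t).
  - exact (is_derive_q3 t).
  - exact (is_derive_r1 t).
  - exact (is_derive_r2 t).
  - exact (is_derive_r3 t).
Qed.

Lemma P_at_0 (e : R) : P0 e 0 = 0 /\ P1 e 0 = 0 /\ P2 e 0 = 0.
Proof.
  unfold P0, P1, P2.
  destruct pqr_at_0 as ((-> & -> & ->) & (-> & -> & ->) & (-> & -> & ->)).
  repeat split; ring.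
Qed.

(* The residual of [P0 e] in the equation for [ln y]. *)
Lemma residual_bound (T : R) :
  exists B K, 1 <= B /\ forall e t, Rabs t <= T -> 21 / 2 * B * Rabs e <= 1 ->
    Rabs (P0 e t) <= 1 / 2 /\
    Rabs (e * cos t * exp (- (7 / 2) * P0 e t)
          - (P3 e t + 3 * P1 e t * P2 e t + P1 e t ^ 3 + 4 * P1 e t)) <= K * e ^ 4.
Proof.
  destruct (bounded_on_segment_list (p1 :: p2 :: p3 :: q1 :: q2 :: q3 :: r1 :: r2 :: r3 :: nil) T)
    as [B [HB1 HB]].
  { intros f Hf t.
    assert (Hd : exists l, is_derive f t l).
    { destruct Hf as [<-|[<-|[<-|[<-|[<-|[<-|[<-|[<-|[<-|[]]]]]]]]]].
      - exists (q1 t). apply is_derive_p1.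
      - exists (q2 t). apply is_derive_p2.
      - exists (q3 t). apply is_derive_p3.
      - exists (r1 t). apply is_derive_q1.
      - exists (r2 t). apply is_derive_q2.
      - exists (r3 t). apply is_derive_q3.
      - exists (s1 t). apply is_derive_r1.
      - exists (s2 t). apply is_derive_r2.
      - exists (s3 t). apply is_derive_r3. }
    destruct Hd as [l Hl]. apply derivable_continuous_pt.
    exists l. now apply is_derive_Reals. }
  destruct (tail4_bound B) as [K HK].
  (* The second summand is the Taylor remainder of the exponential at [- 7/2 P0], where
     [Rabs (P0 e t) <= 3 * B * Rabs e] and [7/2 * 3 = 21/2]. *)
  exists B, (K + 3 * (21 / 2 * B) ^ 3). split; [exact HB1|].
  intros e t Ht He.
  assert (He0 := Rabs_pos e).
  assert (He1 : Rabs e <= 1) by nra.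
  assert (Hb : forall f, In f (p1 :: p2 :: p3 :: q1 :: q2 :: q3 :: r1 :: r2 :: r3 :: nil) ->
    Rabs (f t) <= B) by (intros f Hf; now apply HB). clear HB.
  assert (B1 := Hb p1 ltac:(simpl; tauto)). assert (B2 := Hb p2 ltac:(simpl; tauto)).
  assert (B3 := Hb p3 ltac:(simpl; tauto)). assert (B4 := Hb q1 ltac:(simpl; tauto)).
  assert (B5 := Hb q2 ltac:(simpl; tauto)). assert (B6 := Hb q3 ltac:(simpl; tauto)).
  assert (B7 := Hb r1 ltac:(simpl; tauto)). assert (B8 := Hb r2 ltac:(simpl; tauto)).
  assert (B9 := Hb r3 ltac:(simpl; tauto)). clear Hb.
  assert (HP : Rabs (P0 e t) <= 3 * B * Rabs e).
  { unfold P0.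
    replace (_ + _ + _) with (e * (p1 t + e * p2 t + e * e * p3 t)) by ring.
    rewrite Rabs_mult, Rmult_comm. apply Rmult_le_compat_r; [exact He0|].
    replace (3 * B) with (B + 1 * B + 1 * 1 * B) by ring. bound_abs. }
  split; [lra|].
  assert (Hc : Rabs (cos t) <= 1) by apply Rabs_le, COS_bound.
  assert (HQ := HK (cos t) e _ _ _ _ _ _ _ _ _ Hc He1 B1 B2 B3 B4 B5 B6 B7 B8 B9).
  set (x := - (7 / 2) * P0 e t).
  assert (Hx : Rabs x <= 21 / 2 * B * Rabs e).
  { unfold x. rewrite Rabs_mult, Rabs_Ropp, (Rabs_pos_eq (7 / 2)) by lra. lra. }
  assert (HR := exp_taylor2 x ltac:(lra)).
  set (rem := exp x - 1 - x - x * x / 2) in *.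
  (* The orders [e], [e ^ 2] and [e ^ 3] cancel by the definitions of [s1], [s2] and [s3]. *)
  replace (e * cos t * exp x - _) with
    (e ^ 4 * tail4 (cos t) e (p1 t) (p2 t) (p3 t) (q1 t) (q2 t) (q3 t)
       (r1 t) (r2 t) (r3 t) + e * cos t * rem).
  2:{ replace (exp x) with (rem + 1 + x + x * x / 2) by (unfold rem; ring).
      unfold x, tail4, P0, P1, P2, P3, s1, s2, s3. field. }
  assert (E4 : e ^ 4 = Rabs e ^ 4).
  { rewrite RPow_abs. symmetry. apply Rabs_pos_eq.
    replace (e ^ 4) with ((e * e) * (e * e)) by ring. apply Rle_0_sqr. }
  replace ((K + 3 * (21 / 2 * B) ^ 3) * e ^ 4) with
    (e ^ 4 * K + Rabs e * 1 * (3 * (21 / 2 * B * Rabs e) ^ 3))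
    by (rewrite E4; ring).
  apply Rabs_plus_le.
  - rewrite Rabs_mult, <- RPow_abs, <- E4.
    apply Rmult_le_compat_l; [rewrite E4; now apply pow_le | exact HQ].
  - apply Rabs_mult_le; [apply Rabs_mult_le; [apply Rle_refl | exact Hc]|].
    apply Rle_trans with (1 := HR).
    apply Rmult_le_compat_l; [lra|].
    apply pow_incr. split; [apply Rabs_pos | exact Hx].
Qed.

(** * Comparison of the solution with the expansion *)

Lemma rho_scaling (y0 eps t : R) :
  0 < y0 ->
  eps * rho1 y0 t + eps ^ 2 * rho2 y0 t + eps ^ 3 * rho3 y0 t =
  P0 (eps * Rpower y0 (- (7 / 2))) t.
Proof.
  intros Hy0.
  assert (E2 : / y0 ^ 7 = Rpower y0 (- (7 / 2)) ^ 2).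
  { simpl pow at 2. rewrite Rmult_1_r, <- Rpower_plus.
    replace (- (7 / 2) + - (7 / 2)) with (- INR 7) by (simpl; field).
    now rewrite Rpower_Ropp, Rpower_pow. }
  assert (E3 : 1 / (2592 * Rpower y0 (21 / 2)) = Rpower y0 (- (7 / 2)) ^ 3 / 2592).
  { replace (Rpower y0 (- (7 / 2)) ^ 3) with (/ Rpower y0 (21 / 2)).
    - field. apply Rgt_not_eq, exp_pos.
    - rewrite <- Rpower_Ropp. simpl pow. rewrite Rmult_1_r, <- !Rpower_plus.
      f_equal. field. }
  unfold rho1, rho2, rho3. rewrite E2, E3. unfold P0, p1, p2, p3. field.
Qed.

Lemma ln_lipschitz (c x y : R) :
  0 < c -> c <= x -> c <= y -> Rabs (ln x - ln y) <= / c * Rabs (x - y).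
Proof.
  intros Hc Hx Hy.
  assert (Hm : c <= Rmin y x) by now apply Rmin_glb.
  destruct (MVT_gen ln y x Rinv) as [z [Hz E]].
  - intros z Hz. apply is_derive_Reals, derivable_pt_lim_ln. lra.
  - intros z Hz. apply derivable_continuous_pt. exists (/ z).
    apply derivable_pt_lim_ln. lra.
  - rewrite E, Rabs_mult. apply Rmult_le_compat_r; [apply Rabs_pos|].
    rewrite Rabs_pos_eq; [apply Rinv_le_contravar; lra|].
    left. apply Rinv_0_lt_compat. lra.
Qed.

(** The last factor is the source of the nonlinear terms [3 P' P'' + P' ^ 3] in the equation for the
    logarithm. *)
Lemma is_derive_scal_exp (y0 t : R) (P P' P'' P''' : R -> R) :
  is_derive P t (P' t) -> is_derive P' t (P'' t) -> is_derive P'' t (P''' t) ->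
  is_derive (fun t => y0 * exp (P t)) t (y0 * exp (P t) * P' t) /\
  is_derive (fun t => y0 * exp (P t) * P' t) t
    (y0 * exp (P t) * (P'' t + P' t ^ 2)) /\
  is_derive (fun t => y0 * exp (P t) * (P'' t + P' t ^ 2)) t
    (y0 * exp (P t) * (P''' t + 3 * P' t * P'' t + P' t ^ 3)).
Proof.
  intros H0 H1 H2.
  split; [|split]; (auto_derive; [repeat split; eexists; eassumption|]);
    rw_derive H0; try rw_derive H1; try rw_derive H2; ring.
Qed.

(** Since [- 5/2 = 1 - 7/2], one factor [y0 * exp x] splits off, matching the common factor of the
    derivatives; [eps] then appears only through [eps * y0 ^ (- 7/2)]. *)
Lemma Rpower_scal_exp (y0 x : R) :
  0 < y0 ->
  Rpower (y0 * exp x) (- (5 / 2)) =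
  y0 * exp x * (Rpower y0 (- (7 / 2)) * exp (- (7 / 2) * x)).
Proof.
  intros Hy0. unfold Rpower.
  rewrite ln_mult, ln_exp by (exact Hy0 || apply exp_pos).
  rewrite <- (exp_ln y0) at 2 by exact Hy0.
  rewrite <- !exp_plus. f_equal. field.
Qed.

Theorem mainTheorem3 (y0 : R) (hy0 : 0 < y0)
    (a b : R -> Rbar) (y : R -> R -> R)
    (hy : forall eps : R, is_maximal_solution y0 eps (a eps) (b eps) (y eps))
    (tau : R) :
  exists C : R, locally 0 (fun eps : R =>
    in_interval (a eps) (b eps) tau /\
    exists r : R, Rabs r <= C * eps ^ 4 /\
      y eps tau =
        y0 * exp (eps * rho1 y0 tau + eps ^ 2 * rho2 y0 tau
                  + eps ^ 3 * rho3 y0 tau + r)).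
Proof.
  set (T := Rabs tau + 1).
  assert (HT : 0 < T) by (assert (H := Rabs_pos tau); unfold T; lra).
  destruct (solution_exists y0 T hy0 HT) as [e0 [He0 Hex]].
  destruct (residual_bound T) as [B [K [HB Hres]]].
  set (k := Rpower y0 (- (7 / 2))). assert (Hk : 0 < k) by apply exp_pos.
  set (c := y0 / 2). assert (Hc : 0 < c) by (unfold c; lra).
  set (L := Rabs (- (5 / 2)) * Rpower c (- (5 / 2) - 1)).
  assert (HL : 0 <= L).
  { apply Rmult_le_pos; [apply Rabs_pos | left; apply exp_pos]. }
  (* From left to right: the Lipschitz constant of [ln] above [c], the bound [3 * y0] on [Y], the
     residual constant with [e ^ 4 = k ^ 4 * eps ^ 4], and the Gronwall factor. *)
  exists (/ c * (3 * y0 * (K * k ^ 4) * exp ((7 + L) * Rabs tau))).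
  assert (HBk : 0 < 21 / 2 * B * k) by (apply Rmult_lt_0_compat; lra).
  (* [e0] gives a solution on [(- T, T)], the bound 1 removes [eps] from the Lipschitz constant [L],
     and the last bound is the smallness condition of [residual_bound] for [e = eps * k]. *)
  assert (He1 : 0 < Rmin e0 (Rmin 1 (/ (21 / 2 * B * k)))).
  { repeat apply Rmin_glb_lt; try lra. now apply Rinv_0_lt_compat. }
  exists (mkposreal _ He1). intros eps Heps.
  assert (Heps' : Rabs eps < Rmin e0 (Rmin 1 (/ (21 / 2 * B * k)))).
  { rewrite <- (Rminus_0_r eps). exact Heps. }
  clear Heps. apply Rmin_Rgt_l in Heps'. destruct Heps' as [Hlt0 Heps'].
  apply Rmin_Rgt_l in Heps'. destruct Heps' as [Hlt1 Hlt2].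
  apply Rgt_lt in Hlt0, Hlt1, Hlt2.
  destruct (Hex eps Hlt0) as [u [Hu Hlow]].
  destruct (hy eps) as [Hy _].
  assert (Hin : forall s, Rabs s <= Rabs tau ->
    in_interval (a eps) (b eps) s /\ c <= y eps s).
  { intros s Hs. apply Rabs_le_between in Hs.
    assert (Hs' : in_interval (- T) T s) by (unfold T; split; simpl; lra).
    assert (Hab := maximal_solution_contains _ _ _ _ _ _ _ _ s (hy eps) Hu Hs').
    split; [exact Hab|].
    rewrite <- (solution_unique _ _ _ _ _ _ _ _ s Hy Hu Hab Hs').
    apply Hlow. exact Hs'. }
  assert (Htau := Hin tau (Rle_refl _)).
  split; [apply Htau|].
  set (e := eps * k).
  assert (He : 21 / 2 * B * Rabs e <= 1).
  { unfold e. rewrite Rabs_mult, (Rabs_pos_eq k) by lra.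
    apply Rle_trans with (21 / 2 * B * k * / (21 / 2 * B * k)).
    - replace (21 / 2 * B * (Rabs eps * k)) with (21 / 2 * B * k * Rabs eps) by ring.
      apply Rmult_le_compat_l; lra.
    - right. field. split; lra. }
  set (Y := fun t => y0 * exp (P0 e t)).
  assert (HY : forall t, Rabs t <= T -> c <= Y t <= 3 * y0).
  { intros t Ht. destruct (Hres e t Ht He) as [HP _].
    apply Rabs_le_between in HP.
    assert (H1 := exp_ineq1_le (P0 e t)).
    assert (H2 : exp (P0 e t) <= 3).
    { apply Rle_trans with (exp 1); [apply exp_monotone; lra | apply exp_le_3]. }
    unfold Y, c. nra. }
  assert (HK : 0 <= K * e ^ 4).
  (* The sign of [K] is not known directly; the residual bound at time 0 supplies it. *)
  { eapply Rle_trans; [apply Rabs_pos | apply (Hres e 0); [|exact He]].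
    rewrite Rabs_R0. lra. }
  assert (S := stability (fun t => y eps t - Y t)
    (fun t => Derive (y eps) t - Y t * P1 e t)
    (fun t => Derive_n (y eps) 2 t - Y t * (P2 e t + P1 e t ^ 2))
    (fun t => (eps * cos t * Rpower (y eps t) (- (5 / 2)) - 4 * Derive (y eps) t)
       - Y t * (P3 e t + 3 * P1 e t * P2 e t + P1 e t ^ 3))
    L (3 * y0 * (K * e ^ 4)) tau).
  cbv beta in S.
  assert (Hfin : Rabs (y eps tau - Y tau) <=
    3 * y0 * (K * e ^ 4) * exp ((7 + L) * Rabs tau)).
  { destruct (proj2 (proj2 Hy)) as (Z0 & Z1 & Z2).
    destruct (P_at_0 e) as (Q0 & Q1 & Q2).
    apply S; clear S.
    - exact HL.
    - apply Rmult_le_pos; [lra | exact HK].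
    - unfold Y. rewrite Z0, Q0, exp_0. ring.
    - rewrite Z1, Q1. ring.
    - rewrite Z2, Q1, Q2. ring.
    - intros s Hs.
      assert (Hst : Rabs s <= Rabs tau).
      { revert Hs. unfold Rmin, Rmax, Rabs.
        destruct (Rle_dec 0 tau), (Rcase_abs s), (Rcase_abs tau); lra. }
      assert (HsT : Rabs s <= T) by (unfold T; lra).
      destruct (Hin s Hst) as [Hab Hcy].
      destruct (system_of_solution _ _ _ _ _ _ Hy Hab) as (A0 & A1 & A2).
      destruct (is_derive_P e s) as (R0 & R1 & R2).
      destruct (is_derive_scal_exp y0 s (P0 e) (P1 e) (P2 e) (P3 e) R0 R1 R2)
        as (D0 & D1 & D2).
      split; [exact (is_derive_minus _ _ _ _ _ A0 D0)|].
      split; [exact (is_derive_minus _ _ _ _ _ A1 D1)|].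
      split; [exact (is_derive_minus _ _ _ _ _ A2 D2)|].
      destruct (Hres e s HsT He) as [_ HR]. destruct (HY s HsT) as [HcY HY3].
      set (res := e * cos s * exp (- (7 / 2) * P0 e s)
          - (P3 e s + 3 * P1 e s * P2 e s + P1 e s ^ 3 + 4 * P1 e s)) in *.
      (* The defect splits into the difference of the nonlinearities at [y] and [Y], which is
         Lipschitz in [y - Y], and [Y] times the residual of [P0 e]. *)
      replace (_ + 4 * _) with
        (eps * cos s * (Rpower (y eps s) (- (5 / 2)) - Rpower (Y s) (- (5 / 2)))
         + Y s * res).
      + apply Rabs_plus_le.
        * rewrite <- (Rmult_1_l (L * _)). apply Rabs_mult_le.
          { rewrite <- (Rmult_1_l 1). apply Rabs_mult_le; [lra|].
            apply Rabs_le, COS_bound. }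
          { apply Rpower_lipschitz; lra. }
        * apply Rabs_mult_le; [|exact HR].
          rewrite Rabs_pos_eq; lra.
      + unfold Y at 1. rewrite Rpower_scal_exp by exact hy0.
        fold k. fold (Y s). unfold res, e. ring. }
  (* The error in the exponent is the difference of logarithms, controlled because both arguments
     are at least [c]. *)
  exists (ln (y eps tau) - ln (Y tau)).
  assert (HYtau := HY tau ltac:(unfold T; lra)).
  destruct Htau as [_ Hcy].
  split.
  - apply Rle_trans with (/ c * Rabs (y eps tau - Y tau)).
    + now apply ln_lipschitz.
    + rewrite Rmult_assoc. apply Rmult_le_compat_l.
      { left. now apply Rinv_0_lt_compat. }
      apply Rle_trans with (1 := Hfin). unfold e. right. ring.
  - rewrite rho_scaling by exact hy0. fold k. fold e.
    assert (HlnY : ln (Y tau) = ln y0 + P0 e tau).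
    { unfold Y. rewrite ln_mult, ln_exp by (exact hy0 || apply exp_pos).
      reflexivity. }
    rewrite <- (exp_ln y0) at 1 by exact hy0.
    rewrite <- exp_plus.
    replace (ln y0 + (P0 e tau + (ln (y eps tau) - ln (Y tau))))
      with (ln (y eps tau)) by (rewrite HlnY; ring).
    symmetry. apply exp_ln. lra.
Qed.
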